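(* Let $L>0$, $\mu\in(-\infty,L)$, $\kappa:=\mu/L$, let $f:\mathbb{R}^d\to\mathbb{R}$ belong to $\mathcal{F}_{\mu,L}$ with $f_*:=\inf_xf(x)>-\infty$, and let $N\ge1$ be an integer. Let $x_{i+1}=x_i-\gamma_i\nabla f(x_i)$, $i=0,\dots,N-1$, be $N$ iterations of gradient descent started from $x_0\in\mathbb{R}^d$ with stepsizes $$\gamma_iL:=\begin{cases}\min\{s_i(\kappa),(\gamma L)^*(\kappa)\}, & \kappa<0,\\ s_i(\kappa), & \kappa\ge0,\end{cases}\qquad i=0,\dots,N-1.$$ Then $$\frac1{2L}\min_{0\le i\le N}\big\{\|\nabla f(x_i)\|^2\big\}\le\frac{f(x_0)-f_*}{1+\sum_{i=0}^{N-1}\frac{\gamma_iL(2-\gamma_iL)(2-\kappa\gamma_iL)}{2-\gamma_iL(1+\kappa)}}.$$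
   Context: For $L\in(0,\infty)$ and $\mu\in(-\infty,L)$, $\mathcal{F}_{\mu,L}$ is the class of functions $f:\mathbb{R}^d\to\mathbb{R}$ such that both $\frac{L}{2}\|\cdot\|^2-f$ and $f-\frac{\mu}{2}\|\cdot\|^2$ are convex ($\|\cdot\|$ Euclidean norm; such functions are differentiable). $[x]_+:=\max\{x,0\}$. For $\kappa\in(-\infty,1)$ the sequence $(s_k(\kappa))_{k\ge-1}$ is defined recursively by $s_{-1}(\kappa)=0$ and, for $k\ge-1$, $s_{k+1}(\kappa)$ is the unique $s_+\in\big(1,\frac{2}{1+[\kappa]_+}\big)$ satisfying $$\frac{s_+\big[(2-s_+)(2-\kappa s_+)-1\big]}{2-s_+(1+\kappa)}+\frac{s_k(\kappa)}{2-s_k(\kappa)(1+\kappa)}=0 .$$ For $\kappa<0$, $(\gamma L)^*(\kappa)$ is the unique solution $\ell\in[1,2)$ of $-\kappa(1+\kappa)\ell^3+\big[3\kappa+(1+\kappa)^2\big]\ell^2-4(1+\kappa)\ell+4=0$. *)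

(* Defs.v *)
From mathcomp Require Import all_boot all_order all_algebra.
From mathcomp Require Import all_classical all_reals all_analysis.

Set Implicit Arguments.
Unset Strict Implicit.
Unset Printing Implicit Defensive.

Import Order.TTheory GRing.Theory Num.Theory.
Import numFieldNormedType.Exports.

Local Open Scope classical_set_scope.
Local Open Scope ring_scope.

(* The library norm `|x| on 'rV[R]_d is the sup norm, hence a separate
   Euclidean norm. *)
Definition enorm (R : realType) (d : nat) (x : 'rV[R]_d) : R :=
  Num.sqrt (\sum_(j < d) x 0 j ^+ 2).

Definition grad (R : realType) (d : nat) (f : 'rV[R]_d -> R) (x : 'rV[R]_d) :
    'rV[R]_d :=
  \row_(j < d) 'D_(delta_mx 0 j) f x.

Definition F_class (R : realType) (d : nat) (mu L : R) :
    set ('rV[R]_d -> R) :=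
  [set f |
    convex_function [set: 'rV[R]_d] (fun x => L / 2 * enorm x ^+ 2 - f x) /\
    convex_function [set: 'rV[R]_d] (fun x => f x - mu / 2 * enorm x ^+ 2)].

(* The value s_+ determined by s_k = s; for kappa < 1 and every s = s_k there is
   exactly one candidate, so the default 0 of xget is never used. *)
Definition s_next (R : realType) (kappa s : R) : R :=
  xget 0 [set t : R | 1 < t < 2 / (1 + Num.max kappa 0) /\
    t * ((2 - t) * (2 - kappa * t) - 1) / (2 - t * (1 + kappa))
      + s / (2 - s * (1 + kappa)) = 0].

(* s_{-1} = 0, hence s_k is the (k+1)-st iterate. *)
Definition s_seq (R : realType) (kappa : R) (k : nat) : R :=
  iter k.+1 (s_next kappa) 0.

(* (gamma L)^*; for kappa < 0 the cubic has exactly one root in [1, 2[. *)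
Definition gammaL_star (R : realType) (kappa : R) : R :=
  xget 0 [set l : R | 1 <= l < 2 /\
    - kappa * (1 + kappa) * l ^+ 3 + (3 * kappa + (1 + kappa) ^+ 2) * l ^+ 2
      - 4 * (1 + kappa) * l + 4 = 0].

Definition normalized_step (R : realType) (kappa : R) (i : nat) : R :=
  if kappa < 0 then Num.min (s_seq kappa i) (gammaL_star kappa)
  else s_seq kappa i.

(* Main.v *)
Require Import Defs.
From mathcomp Require Import all_boot all_order all_algebra.
From mathcomp Require Import all_classical all_reals all_analysis.
From mathcomp Require Import ring lra.
Import Order.TTheory GRing.Theory Num.Theory.
Import numFieldNormedType.Exports.
Local Open Scope classical_set_scope.
Local Open Scope ring_scope.

(** Write [t] for the normalized stepsize gamma * L and D = 2 - t (1 + kappa).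
    A function of the class lies, around every point, between two parabolas
    of curvatures mu and L that touch it with slope [grad f]
    ([F_class_quadratic]).  Comparing the lower parabola at one point with the
    upper one at another gives the interpolation inequality
    [F_class_interpolation].  For two consecutive iterates x and y with
    gradients g and h, the inequality used in both directions with multipliers
    1 + beta and beta, where beta = (t - 1) / D cancels the cross term <g, h>,
    gives for t >= 1 ([gradient_step_decrease])

      f x - f y >= (A t * |g|^2 + B t * |h|^2) / (2 L),
      A t = t ((2 - t) (2 - kappa t) - 1) / D,   B t = t / D,

    with A and B called [pre_weight] and [post_weight].

    The sum A t + B t is the summand of the rate.  Along the iterates, |g_i|^2
    therefore collects the coefficient A t_i + B t_(i-1), and the recursion of
    s_k says exactly that this coefficient vanishes for the uncapped
    stepsizes.  What has to be shown is that it stays nonnegative when the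
    steps are capped at (gamma L)^*; then every |g_i|^2 may be replaced by the
    smallest one ([balanced_descent]).  The identity
    1 - A t = (t - 1)^2 (1 + B t) shows that A decreases on t >= 1, whence s_k
    is nondecreasing, so that a capped step is followed by capped steps only.
    If the current step is the first capped one, the cap lowers it and thus
    increases A; if the previous one is capped as well, both equal the cap and
    A + B >= 0 ([capped_stepP]).  A final step of length 1 / L from the last
    iterate accounts for the 1 in the denominator. *)

(** * Euclidean inner product *)

Section dot.
Context {R : realType} {d : nat}.
Implicit Types (u v w : 'rV[R]_d) (a : R).

Definition dot u v : R := \sum_(j < d) u 0 j * v 0 j.

Lemma dotC u v : dot u v = dot v u.
Proof. by apply: eq_bigr => j _; rewrite mulrC. Qed.

Lemma dotDl u v w : dot (u + v) w = dot u w + dot v w.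
Proof. by rewrite -big_split; apply: eq_bigr => j _; rewrite mxE mulrDl. Qed.

Lemma dotZl a u v : dot (a *: u) v = a * dot u v.
Proof. by rewrite mulr_sumr; apply: eq_bigr => j _; rewrite mxE mulrA. Qed.

Lemma dotNl u v : dot (- u) v = - dot u v.
Proof. by rewrite -scaleN1r dotZl mulN1r. Qed.

Lemma dotDr u v w : dot u (v + w) = dot u v + dot u w.
Proof. by rewrite dotC dotDl !(dotC u). Qed.

Lemma dotZr a u v : dot u (a *: v) = a * dot u v.
Proof. by rewrite dotC dotZl dotC. Qed.

Lemma dotNr u v : dot u (- v) = - dot u v.
Proof. by rewrite dotC dotNl dotC. Qed.

Definition dotE := (dotDl, dotDr, dotNl, dotNr, dotZl, dotZr).

Lemma enorm_sqr u : enorm u ^+ 2 = dot u u.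
Proof.
rewrite /enorm sqr_sqrtr; first by apply: eq_bigr => j _; rewrite expr2.
by apply: sumr_ge0 => j _; rewrite sqr_ge0.
Qed.

End dot.

(** * Quadratic bounds and the gradient *)

Lemma eq0_le_sqr (R : realType) (a K : R) :
  (forall t, t * a <= K * t ^+ 2) -> a = 0.
Proof.
move=> aK; set k := `|K| + 1.
have k_gt0 : 0 < k by rewrite /k; have := normr_ge0 K; lra.
have Kk : K <= k by rewrite /k; have := ler_norm K; lra.
have := aK (a / (2 * k)).
have -> : a / (2 * k) * a = 2 * (k * (a / (2 * k)) ^+ 2) by field; lra.
set s := (_ / _) ^+ 2 => h.
have s_ge0 : 0 <= s by rewrite sqr_ge0.
have ks0 : k * s <= 0 by have := ler_wpM2r s_ge0 Kk; lra.
have s0 : s = 0.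
  by apply/eqP; rewrite eq_le s_ge0 andbT -(pmulr_rle0 _ k_gt0).
move/eqP: s0; rewrite /s sqrf_eq0 mulf_eq0 invr_eq0 => /orP[/eqP//|/eqP]; lra.
Qed.

Section slope.
Context {R : realType}.

(** For s < 0 < t, the two hypotheses at 0 = p s + (1 - p) t say that the
    difference quotient corrected by - m t increases from s to t, and that the
    one corrected by - M t decreases.  The supremum of the former over s < 0
    then serves as the slope on both sides, because the two corrections differ
    by (M - m) t, which is arbitrarily small.  The constants do
    not deteriorate: t = 1 already gives [F_class_quadratic]. *)
Lemma quadratic_slope (phi : R -> R) (m M : R) : phi 0 = 0 ->
  (forall p a b, 0 <= p <= 1 ->
     phi (p * a + (1 - p) * b) <=
       p * phi a + (1 - p) * phi b - m * (p * (1 - p) * (a - b) ^+ 2)) ->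
  (forall p a b, 0 <= p <= 1 ->
     p * phi a + (1 - p) * phi b - M * (p * (1 - p) * (a - b) ^+ 2) <=
     phi (p * a + (1 - p) * b)) ->
  exists D, forall t, m * t ^+ 2 <= phi t - t * D <= M * t ^+ 2.
Proof.
move=> phi0 lo hi.
pose psi c t := phi t / t - c * t.
have cross s t : s < 0 -> 0 < t ->
    psi m s <= psi m t /\ psi M t <= psi M s.
  move=> s0 t0; pose p := t / (t - s).
  have ts0 : 0 < t - s by lra.
  have p01 : 0 <= p <= 1.
    by rewrite /p ler_pdivlMr// ler_pdivrMr//; apply/andP; split; lra.
  have E0 : p * s + (1 - p) * t = 0 by rewrite /p; field; lra.
  have c_gt0 : 0 < - (s * t) / (t - s).
    by rewrite divr_gt0// -mulNr mulr_gt0//; lra.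
  have EQ c : p * phi s + (1 - p) * phi t - c * (p * (1 - p) * (s - t) ^+ 2)
      = (- (s * t) / (t - s)) * (psi c t - psi c s).
    by rewrite /psi /p; field; apply/and3P; split; apply/eqP; lra.
  have := lo p s t p01; have := hi p s t p01.
  by rewrite E0 phi0 !EQ pmulr_rge0// pmulr_rle0//; split; lra.
(* D bounds psi m from above on t < 0 and from below on t > 0. *)
pose S := [set psi m s | s in [set s : R | s < 0]].
have S_ub t : 0 < t -> ubound S (psi m t).
  by move=> t0 _ [s s0 <-]; have [] := cross _ _ s0 t0.
have S_sup : has_sup S.
  split; first by exists (psi m (-1)), (-1) => //=; lra.
  by exists (psi m 1); apply: S_ub; lra.
pose D := sup S; exists D.
have D_lo s : s < 0 -> psi m s <= D.
  by move=> s0; apply: ub_le_sup; [case: S_sup|exists s].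
have D_hi t : 0 < t -> D <= psi m t.
  by move=> t0; apply: ge_sup; [case: S_sup|apply: S_ub].
have psiD c c' t : psi c t = psi c' t + (c' - c) * t by rewrite /psi; ring.
have mM : m <= M.
  have N1 : (-1 : R) < 0 by lra.
  have [] := cross (-1) 1 N1 ltr01; rewrite !(psiD M m); lra.
have small e : 0 < e -> (M - m) * (e / (M - m + 1)) <= e.
  by move=> e0; rewrite mulrCA ler_piMr ?ler_pdivrMr; lra.
(* The upper bound passes through psi M at a point s slightly below 0. *)
have D_hiM t : 0 < t -> psi M t <= D.
  move=> t0; apply/ler_addgt0Pr => e e0.
  have s0 : - (e / (M - m + 1)) < 0 by rewrite oppr_lt0 divr_gt0//; lra.
  have [_] := cross _ _ s0 t0; have := D_lo _ s0; have := small _ e0.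
  rewrite (psiD M m (- _)); lra.
have D_loM s : s < 0 -> D <= psi M s.
  move=> s0; apply/ler_addgt0Pr => e e0.
  have t0 : 0 < e / (M - m + 1) by rewrite divr_gt0//; lra.
  have [_] := cross _ _ s0 t0; have := D_hi _ t0; have := small _ e0.
  rewrite (psiD M m (_ / _)); lra.
move=> t.
have phiE c : t != 0 -> phi t - t * D = c * t ^+ 2 + t * (psi c t - D).
  by move=> t0; rewrite /psi; field.
case: (ltrgtP t 0) => t0; last by rewrite t0 phi0; apply/andP; split; lra.
- have tN0 : t != 0 by rewrite lt_eqF.
  have := D_lo _ t0; have := D_loM _ t0 => h1 h2.
  rewrite {1}(phiE m)// (phiE M)// lerDl gerDl.
  by rewrite nmulr_rge0// nmulr_rle0//; apply/andP; split; lra.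
- have tN0 : t != 0 by rewrite gt_eqF.
  have := D_hi _ t0; have := D_hiM _ t0 => h1 h2.
  rewrite {1}(phiE m)// (phiE M)// lerDl gerDl.
  by rewrite pmulr_rge0// pmulr_rle0//; apply/andP; split; lra.
Qed.

Context {d : nat}.
Implicit Types (f : 'rV[R]_d -> R) (x y v : 'rV[R]_d).

Lemma convex_functionP f : convex_function [set: 'rV[R]_d] f ->
  forall p x y, 0 <= p <= 1 ->
    f (p *: x + (1 - p) *: y) <= p * f x + (1 - p) * f y.
Proof.
move=> cf p x y /andP[p0 p1].
have p01 : Itv.spec (@Itv.num_sem R) (Itv.Real `[0%Z, 1%Z]) p.
  by rewrite /= /Itv.num_sem /= in_itv /= p0 p1 num_real.
exact: (cf (Itv.mk p01) x y (in_setT _) (in_setT _)).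
Qed.

(** Convexity of f - mu/2 |.|^2 and of L/2 |.|^2 - f, rewritten with
    p |x|^2 + (1 - p) |y|^2 - |p x + (1 - p) y|^2 = p (1 - p) |x - y|^2, so that
    the parabola no longer depends on the position of the points. *)
Lemma F_class_secant mu L f : F_class mu L f ->
  forall p x y, 0 <= p <= 1 ->
    f (p *: x + (1 - p) *: y) <= p * f x + (1 - p) * f y
      - mu / 2 * (p * (1 - p) * dot (x - y) (x - y)) /\
    p * f x + (1 - p) * f y - L / 2 * (p * (1 - p) * dot (x - y) (x - y))
      <= f (p *: x + (1 - p) *: y).
Proof.
move=> [/convex_functionP cL /convex_functionP cmu] p x y p01.
have := cL p x y p01; have := cmu p x y p01.
rewrite !enorm_sqr !dotE (dotC y x).
by split; nra.
Qed.

(** Both bounds hold for all real [t], which makes [a] a two-sided directional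
    derivative with a quadratic remainder. *)
Definition slope mu L f x v a := forall t,
  mu / 2 * dot v v * t ^+ 2 <= f (x + t *: v) - f x - t * a
    <= L / 2 * dot v v * t ^+ 2.

Lemma slope_exists mu L f x v : F_class mu L f -> exists a, slope mu L f x v a.
Proof.
move=> fF; have sec := F_class_secant _ _ _ fF.
pose phi t := f (x + t *: v) - f x.
have lineE p a b : x + (p * a + (1 - p) * b) *: v
    = p *: (x + a *: v) + (1 - p) *: (x + b *: v).
  by apply/rowP => j; rewrite !mxE; ring.
have diffE a b : dot (x + a *: v - (x + b *: v)) (x + a *: v - (x + b *: v))
    = dot v v * (a - b) ^+ 2.
  by rewrite !dotE; ring.
have [|p a b p01|p a b p01|D HD] :=
  quadratic_slope phi (mu / 2 * dot v v) (L / 2 * dot v v).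
- by rewrite /phi scale0r addr0 subrr.
- have [+ _] := sec p (x + a *: v) (x + b *: v) p01.
  by rewrite /phi lineE diffE; lra.
- have [_] := sec p (x + a *: v) (x + b *: v) p01.
  by rewrite /phi lineE diffE; lra.
- by exists D.
Qed.

Lemma slopeZ mu L f x v a c : slope mu L f x v a ->
  slope mu L f x (c *: v) (c * a).
Proof.
move=> H t; have := H (t * c); rewrite scalerA !dotE.
by move=> /andP[lo hi]; apply/andP; split; lra.
Qed.

(** Convexity at the midpoint of x + 2 t u and x + 2 t v bounds t (c - a - b) by
    a multiple of t^2 for both signs of [t]. *)
Lemma slopeD mu L f x u v a b c : F_class mu L f ->
  slope mu L f x u a -> slope mu L f x v b -> slope mu L f x (u + v) c ->
  c = a + b.
Proof.
move=> fF Hu Hv Huv; apply/eqP; rewrite -subr_eq0; apply/eqP.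
pose Q := dot (u - v) (u - v); pose S := dot (u + v) (u + v).
apply: (eq0_le_sqr _ _ (L * dot u u + L * dot v v - mu / 2 * Q - mu / 2 * S)).
move=> t.
have p01 : 0 <= (1 / 2 : R) <= 1 by apply/andP; split; lra.
have [+ _] := F_class_secant _ _ _ fF _ (x + (2 * t) *: u)
  (x + (2 * t) *: v) p01.
have -> : 1 / 2 *: (x + (2 * t) *: u) + (1 - 1 / 2) *: (x + (2 * t) *: v)
    = x + t *: (u + v) by apply/rowP => j; rewrite !mxE; field.
have -> : dot (x + (2 * t) *: u - (x + (2 * t) *: v))
    (x + (2 * t) *: u - (x + (2 * t) *: v)) = 4 * t ^+ 2 * Q.
  by rewrite /Q !dotE; ring.
have /andP[_ hu] := Hu (2 * t); have /andP[_ hv] := Hv (2 * t).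
have /andP[huv _] := Huv t.
by rewrite -/S in huv; lra.
Qed.

Lemma derive_slope mu L f x v a : slope mu L f x v a -> 'D_v f x = a.
Proof.
move=> H; apply: cvg_lim => //.
pose K := `|mu / 2 * dot v v| + `|L / 2 * dot v v|.
have K_ge t : - (K * t ^+ 2) <= f (x + t *: v) - f x - t * a <= K * t ^+ 2.
  have /andP[lo hi] := H t; have t2 := sqr_ge0 t.
  have h1 : - K <= mu / 2 * dot v v.
    by rewrite /K; have := ler_norm (- (mu / 2 * dot v v)); rewrite normrN;
       have := normr_ge0 (L / 2 * dot v v); lra.
  have h2 : L / 2 * dot v v <= K.
    by rewrite /K; have := ler_norm (L / 2 * dot v v);
       have := normr_ge0 (mu / 2 * dot v v); lra.
  have := ler_wpM2r t2 h1; have := ler_wpM2r t2 h2.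
  by move=> h3 h4; apply/andP; split; lra.
apply: (@squeeze_cvgr _ _ _ _ (fun t : R => a - K * `|t|)
  (fun t => a + K * `|t|)).
- near=> t.
  have tN0 : t != 0 by near: t; exact: nbhs_dnbhs_neq.
  have nt0 : 0 < `|t| by rewrite normr_gt0.
  rewrite /= [t *: v + x]addrC -ler_distl.
  have -> : t^-1 *: (f (x + t *: v) - f x) - a
      = t^-1 * (f (x + t *: v) - f x - t * a) by rewrite /GRing.scale/=; field.
  rewrite normrM normfV ler_pdivrMl// mulrCA -expr2 real_normK ?num_real//.
  by rewrite ler_norml K_ge.
- have -> : a = a - K * `|0 : R| by rewrite normr0 mulr0 subr0.
  apply: cvg_within_filter; apply: cvgB;
    first by rewrite normr0 mulr0 subr0; exact: cvg_cst.
  by apply: cvgM; [exact: cvg_cst|exact: norm_continuous].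
- have -> : a = a + K * `|0 : R| by rewrite normr0 mulr0 addr0.
  apply: cvg_within_filter; apply: cvgD;
    first by rewrite normr0 mulr0 addr0; exact: cvg_cst.
  by apply: cvgM; [exact: cvg_cst|exact: norm_continuous].
Unshelve. all: by end_near. Qed.

(** The slopes in the various directions form a linear functional, whose
    values on the unit vectors are the partial derivatives. *)
Lemma slope_grad mu L f x v : F_class mu L f ->
  slope mu L f x v (dot (grad f x) v).
Proof.
move=> fF; have [D HD] := choice (fun v => slope_exists mu L f x v fF).
suff -> : dot (grad f x) v = D v by [].
have DD u w : D (u + w) = D u + D w.
  exact: (slopeD _ _ _ _ _ _ _ _ _ fF (HD u) (HD w) (HD _)).
have D0 : D 0 = 0 by have := DD 0 0; rewrite addr0; lra.
have DZ c u : D (c *: u) = c * D u.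
  have cu := slopeZ _ _ _ _ _ _ c (HD u).
  have cu0 : slope mu L f x (c *: u + 0) (c * D u) by rewrite addr0.
  by have := slopeD _ _ _ _ _ _ _ _ _ fF (HD (c *: u)) (HD 0) cu0;
     rewrite D0; lra.
rewrite [v in RHS]row_sum_delta (big_morph D DD D0); apply: eq_bigr => j _.
by rewrite DZ mxE mulrC (derive_slope _ _ _ _ _ _ (HD _)).
Qed.

Lemma F_class_quadratic mu L f x y : F_class mu L f ->
  mu / 2 * dot (y - x) (y - x) <= f y - f x - dot (grad f x) (y - x)
    <= L / 2 * dot (y - x) (y - x).
Proof.
move=> fF; have := slope_grad mu L f x (y - x) fF 1.
by rewrite scale1r subrKC expr1n !mulr1 mul1r.
Qed.

(** Evaluate the lower parabola at y and the upper one at x in the same point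
    z: it minimizes the gap between the two parabolas. *)
Lemma F_class_interpolation mu L f x y : mu < L -> F_class mu L f ->
  dot (grad f y) (x - y) + mu / 2 * dot (x - y) (x - y)
    + dot (grad f x - grad f y - mu *: (x - y))
          (grad f x - grad f y - mu *: (x - y)) / (2 * (L - mu))
  <= f x - f y.
Proof.
move=> muL fF; set w := _ - _ - _ *: _.
pose z := x - (L - mu)^-1 *: w.
have /andP[lo _] := F_class_quadratic _ _ _ y z fF.
have /andP[_ hi] := F_class_quadratic _ _ _ x z fF.
have zx : z - x = - ((L - mu)^-1 *: w) by rewrite /z addrC addKr.
have zy : z - y = (x - y) - (L - mu)^-1 *: w by rewrite /z addrAC.
have wE : dot w w = dot (grad f x) w - dot (grad f y) w - mu * dot (x - y) w.
  by rewrite {1}/w !dotE; ring.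
move: lo hi; rewrite zx zy; move: (x - y) wE => u wE.
have -> : dot (u - (L - mu)^-1 *: w) (u - (L - mu)^-1 *: w)
    = dot u u - 2 * (L - mu)^-1 * dot u w + (L - mu)^-1 ^+ 2 * dot w w.
  by rewrite !(dotDl u, dotDr _ u, dotNl, dotNr, dotZl, dotZr) (dotC w u); ring.
rewrite (dotDr _ u) !(dotNl, dotNr, dotZl, dotZr).
have -> : dot w w / (2 * (L - mu)) = (L - mu)^-1 * dot w w / 2 by field; lra.
have kE : (L - mu) * (L - mu)^-1 = 1 by rewrite mulfV//; lra.
move: (L - mu)^-1 kE => k kE lo hi.
have wkE : k * dot w w
    = k * (dot (grad f x) w - dot (grad f y) w - mu * dot u w) by rewrite wE.
have kkE : (L - mu) * (k ^+ 2 * dot w w) = k * dot w w.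
  by rewrite -[RHS]mul1r -kE; ring.
by lra.
Qed.
End slope.

(** * One gradient step *)

(** [pre_weight] and [post_weight] are the coefficients with which the squared
    gradient norms before and after a step of normalized length [t] enter the
    guaranteed decrease of 2 L f. *)
Definition pre_weight {R : realType} (kappa t : R) : R :=
  t * ((2 - t) * (2 - kappa * t) - 1) / (2 - t * (1 + kappa)).

Definition post_weight {R : realType} (kappa t : R) : R :=
  t / (2 - t * (1 + kappa)).

Lemma pre_post_weight (R : realType) (kappa t : R) :
  pre_weight kappa t + post_weight kappa t =
  t * (2 - t) * (2 - kappa * t) / (2 - t * (1 + kappa)).
Proof. by rewrite /pre_weight /post_weight; ring. Qed.

(** The multipliers 1 + beta and beta of the two interpolation inequalities
    differ by 1, so that the sum of the inequalities bounds f x - f y; the value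
    of beta is the one for which the inner product of both gradients drops
    out.  It is nonnegative because [t] is at least 1. *)
Lemma gradient_step_decrease (R : realType) (d : nat) (L mu kappa gam : R)
    (f : 'rV[R]_d -> R) (x : 'rV[R]_d) :
  0 < L -> mu < L -> kappa = mu / L -> F_class mu L f ->
  1 <= gam * L -> 0 < 2 - gam * L * (1 + kappa) ->
  (pre_weight kappa (gam * L) * enorm (grad f x) ^+ 2 +
   post_weight kappa (gam * L) *
     enorm (grad f (x - gam *: grad f x)) ^+ 2) / (2 * L)
  <= f x - f (x - gam *: grad f x).
Proof.
move=> L_gt0 muL kappaE fF t_ge1 D_gt0.
set y := x - _.
have fwd := F_class_interpolation _ _ _ x y muL fF.
have bwd := F_class_interpolation _ _ _ y x muL fF.
have xy : x - y = gam *: grad f x by rewrite /y opprB addrC subrK.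
have yx : y - x = - (gam *: grad f x) by rewrite -xy opprB.
rewrite !enorm_sqr; move: fwd bwd; rewrite xy yx.
move: (grad f x) (grad f y) => g h.
rewrite !dotE (dotC h g).
set t := gam * L in t_ge1 D_gt0 *.
pose beta := (t - 1) / (2 - t * (1 + kappa)).
have beta_ge0 : 0 <= beta by rewrite divr_ge0//; lra.
move=> fwd bwd.
have := ler_wpM2l beta_ge0 bwd; have beta1_ge0 : 0 <= 1 + beta by lra.
move=> {}bwd.
have := lerD (ler_wpM2l beta1_ge0 fwd) bwd.
have -> : (1 + beta) * (f x - f y) + beta * (f y - f x) = f x - f y by ring.
apply: le_trans; rewrite le_eqVlt; apply/orP; left; apply/eqP.
have muE : mu = kappa * L by rewrite kappaE divfK// gt_eqF.
have gamE : gam = t / L by rewrite /t mulfK// gt_eqF.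
rewrite /pre_weight /post_weight /beta muE gamE.
move: muL D_gt0; rewrite muE; clear -L_gt0; move: t => t muL D_gt0.
by field; repeat (apply/andP; split); apply/eqP; lra.
Qed.

(** * The stepsizes *)
Section stepsizes.
Context {R : realType} (kappa : R).

Implicit Types s t : R.

(** The range of the iterates s_k, including s_{-1} = 0. *)
Definition in_range (t : R) : bool := 0 <= t < 2 / (1 + Num.max kappa 0).

Lemma in_rangeP t : in_range t ->
  [/\ 0 <= t, t < 2, kappa * t < 2 & 0 < 2 - t * (1 + kappa)].
Proof.
rewrite /in_range => /andP[t0]; rewrite ltr_pdivlMr; last first.
  by have : 0 <= Num.max kappa 0 by [rewrite le_max lexx orbT]; lra.
case: (ltrP kappa 0) => k0 ht.
- by split; nra.
- by split; nra.
Qed.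

Lemma post_weight_ge0 t : in_range t -> 0 <= post_weight kappa t.
Proof. by move=> /in_rangeP[t0 _ _ D0]; rewrite divr_ge0// ltW. Qed.

Lemma step_gain_gt0 t : 0 < t -> in_range t ->
  0 < pre_weight kappa t + post_weight kappa t.
Proof.
move=> t_gt0 /in_rangeP[_ t2 kt D0]; rewrite pre_post_weight.
by rewrite divr_gt0 ?mulr_gt0//; lra.
Qed.

(** The form that makes the monotonicity of [pre_weight] visible. *)
Lemma pre_weightE t : in_range t ->
  pre_weight kappa t = 1 - (t - 1) ^+ 2 * (1 + post_weight kappa t).
Proof.
move=> /in_rangeP[t0 t2 kt D0]; rewrite /pre_weight /post_weight; field; lra.
Qed.

Lemma post_weight_homo s t : in_range s -> in_range t -> s <= t ->
  post_weight kappa s <= post_weight kappa t.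
Proof.
move=> /in_rangeP[s0 _ _ Ds] /in_rangeP[t0 _ _ Dt] st.
rewrite /post_weight ler_pdivrMr// mulrAC ler_pdivlMr//; lra.
Qed.

Lemma pre_weight_anti s t : in_range s -> in_range t -> 1 <= s -> s <= t ->
  pre_weight kappa t <= pre_weight kappa s.
Proof.
move=> rs rt s1 st; rewrite !pre_weightE// lerB//.
have p := post_weight_homo _ _ rs rt st; have := post_weight_ge0 _ rs => p0.
by apply: ler_pM; rewrite ?sqr_ge0 ?lerD2l//;
  [lra|rewrite lerXn2r ?nnegrE; lra].
Qed.

(** After clearing the positive denominator of [pre_weight], the recursion
    becomes a cubic G in t that changes sign.  With b the [post_weight] of [s],
    it is (1 - kappa) (1 + b) at 1; at the right end it is - 2 - 2 kappa b, with
    b < - 1 / kappa, if kappa is negative, and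
    - 2 (1 - kappa)^2 / (1 + kappa)^3 otherwise. *)
Lemma s_next_exists s : kappa < 1 -> in_range s -> exists t,
  1 < t < 2 / (1 + Num.max kappa 0) /\
  pre_weight kappa t + post_weight kappa s = 0.
Proof.
move=> k_lt1 rs; have [s0 s2 ks Ds] := in_rangeP _ rs.
have b0 := post_weight_ge0 _ rs.
set T : R := 2 / _.
set b := post_weight kappa s in b0 *.
have T1 : 1 < T.
  have m_ge0 : 0 <= Num.max kappa 0 by rewrite le_max lexx orbT.
  have m_lt1 : Num.max kappa 0 < 1 by rewrite gt_max k_lt1 ltr01.
  by rewrite ltr_pdivlMr; lra.
(* The cubic G with reversed sign, negative at 1 and positive at T. *)
pose p : {poly R} := - ('X * ((2%:P - 'X) * (2%:P - kappa *: 'X) - 1)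
   + b *: (2%:P - (1 + kappa) *: 'X)).
have pE t : p.[t] = - (t * ((2 - t) * (2 - kappa * t) - 1)
   + b * (2 - t * (1 + kappa))).
  by rewrite /p !hornerE; ring.
have p1 : p.[1] < 0 by rewrite pE; nra.
have pT : 0 < p.[T].
  rewrite pE /T; case: (ltrP kappa 0) => k0.
    have : b * (- kappa) < 1.
      by rewrite /b /post_weight mulrAC ltr_pdivrMr//; nra.
    by rewrite addr0 divr1; lra.
  rewrite [ltRHS](_ : _ = 2 * (1 - kappa) ^+ 2 / (1 + kappa) ^+ 3);
    last by field; lra.
  by rewrite divr_gt0// ?mulr_gt0 ?exprn_gt0//; lra.
have [|t /andP[t1 tT] /rootP pt] := @poly_ivt R p 1 T (ltW T1).
  by rewrite !ltW.
have {}t1 : 1 < t.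
  rewrite lt_neqAle t1 andbT; apply/eqP => t1E.
  by rewrite t1E pt ltxx in p1.
have {}tT : t < T.
  rewrite lt_neqAle tT andbT; apply/eqP => tTE.
  by rewrite -tTE pt ltxx in pT.
have rt : in_range t by rewrite /in_range -/T tT andbT; lra.
exists t; rewrite t1 tT; split => //.
have [_ _ _ Dt] := in_rangeP _ rt.
have -> : pre_weight kappa t + b = - p.[t] / (2 - t * (1 + kappa)).
  by rewrite pE /pre_weight; field; lra.
by rewrite pt oppr0 mul0r.
Qed.

Lemma s_nextP s : kappa < 1 -> in_range s ->
  [/\ in_range (s_next kappa s), 1 < s_next kappa s &
      pre_weight kappa (s_next kappa s) + post_weight kappa s = 0].
Proof.
move=> k1 rs.
have [/andP[gt1 ltT] eq0] := xgetPex 0 (s_next_exists _ k1 rs).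
split=> //; rewrite /in_range; apply/andP; split=> //.
by rewrite (le_trans _ (ltW gt1)).
Qed.

(** A smaller successor s' would have A s <= A s' = - B s, against
    A s + B s > 0. *)
Lemma s_next_ge s : kappa < 1 -> in_range s -> s <= s_next kappa s.
Proof.
move=> k1 rs; have [rn n1 eq0] := s_nextP _ k1 rs.
rewrite leNgt; apply/negP => ns.
have s_gt0 : 0 < s by lra.
have := pre_weight_anti _ _ rn rs (ltW n1) (ltW ns).
have := step_gain_gt0 _ s_gt0 rs; lra.
Qed.

Lemma iter_s_next_in_range k : kappa < 1 -> in_range (iter k (s_next kappa) 0).
Proof.
move=> k1; elim: k => [|k IH] /=; last by have [] := s_nextP _ k1 IH.
rewrite /in_range lexx divr_gt0//.
by have : 0 <= Num.max kappa 0 by [rewrite le_max lexx orbT]; lra.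
Qed.

(** At 1 the cubic equals 1, and at 2 it equals 4 kappa (1 - kappa) < 0. *)
Lemma gammaL_starP : kappa < 0 -> 1 <= gammaL_star kappa < 2.
Proof.
move=> k0; rewrite /gammaL_star.
set S := [set l : R | _].
suff /(xgetPex 0) [] : exists l, S l by [].
pose p : {poly R} := kappa * (1 + kappa) *: 'X^3
  - (3 * kappa + (1 + kappa) ^+ 2) *: 'X^2 + (4 * (1 + kappa)) *: 'X - 4%:P.
have pE t : p.[t] = - (- kappa * (1 + kappa) * t ^+ 3
    + (3 * kappa + (1 + kappa) ^+ 2) * t ^+ 2 - 4 * (1 + kappa) * t + 4).
  by rewrite /p !(hornerD, hornerN, hornerZ, hornerXn, hornerX, hornerC); ring.
have p1 : p.[1] <= 0 by rewrite pE; nra.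
have p2 : 0 < p.[2] by rewrite pE; nra.
have [||t /andP[t1 t2] /rootP pt] := @poly_ivt R p 1 2;
  [lra|by rewrite p1 ltW|].
exists t; split; last by move: pt; rewrite pE; lra.
rewrite t1 lt_neqAle t2 andbT; apply/eqP => tE.
by rewrite -tE pt ltxx in p2.
Qed.

(** The stepsizes with the index shifted by one, so that [capped_step 0] is the
    fictitious step s_{-1} = 0 before the first one. *)
Definition capped_step k : R :=
  if kappa < 0 then Num.min (iter k (s_next kappa) 0) (gammaL_star kappa)
  else iter k (s_next kappa) 0.

Lemma capped_step0 : capped_step 0 = 0.
Proof.
rewrite /capped_step; case: ifP => // /gammaL_starP g1.
by apply/min_idPl => /=; lra.
Qed.

(** The last inequality means that the coefficient of each squared gradient
    norm in the telescoped decrease is nonnegative. *)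
Lemma capped_stepP k : kappa < 1 ->
  [/\ in_range (capped_step k.+1), 1 <= capped_step k.+1 &
      0 <= pre_weight kappa (capped_step k.+1)
           + post_weight kappa (capped_step k)].
Proof.
move=> k1; have rs := iter_s_next_in_range k k1.
have [rn n1 eq0] := s_nextP _ k1 rs; have sn := s_next_ge _ k1 rs.
rewrite /capped_step iterS; set s := iter k _ _ in rs rn n1 eq0 sn *.
case: ifP => k0; last by split=> //; lra.
have /andP[g1 g2] := gammaL_starP k0; set g := gammaL_star _ in g1 g2 *.
have rg : in_range g.
  rewrite /in_range (max_idPr (ltW k0)) addr0 divr1 g2 andbT; lra.
(* No capping, capping of the new step only, capping of both steps. *)
have [ng|gn] := leP (s_next kappa s) g.
  by rewrite (min_idPl (le_trans sn ng)); split=> //; lra.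
split=> //; have [sg|gs] := leP s g.
  have := pre_weight_anti _ _ rg rn g1 (ltW gn); lra.
by apply/ltW/step_gain_gt0 => //; lra.
Qed.
End stepsizes.

(** * Telescoping and the rate *)

(** Summation by parts: the partial sums keep the surplus of the last
    [post_weight], which the next [pre_weight] may consume.  Initially there is
    no surplus, as [t 0 = 0]. *)
Lemma balanced_descent (R : realType) (kappa c m : R) (N : nat)
    (t : nat -> R) (F G : nat -> R) :
  t 0%N = 0 -> 0 <= c ->
  (forall i, (i <= N)%N -> m <= G i) ->
  (forall i, (i < N)%N ->
     0 <= pre_weight kappa (t i.+1) + post_weight kappa (t i)) ->
  (forall i, (i < N)%N ->
     (pre_weight kappa (t i.+1) * G i + post_weight kappa (t i.+1) * G i.+1) * c
     <= F i - F i.+1) ->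
  c * (m * (\sum_(i < N)
              (pre_weight kappa (t i.+1) + post_weight kappa (t i.+1)))
     + post_weight kappa (t N) * (G N - m)) <= F 0%N - F N.
Proof.
move=> t0 c0 mG bal desc; elim: N mG bal desc => [|N IH] mG bal desc.
  by rewrite big_ord0 t0 /post_weight !mul0r; lra.
rewrite big_ord_recr/=.
have := IH (fun i h => mG i (leqW h)) (fun i h => bal i (leqW h))
  (fun i h => desc i (leqW h)).
have := desc N (ltnSn N).
have GN : 0 <= G N - m by rewrite subr_ge0 mG.
have := mulr_ge0 c0 (mulr_ge0 (bal N (ltnSn N)) GN).
set S := \sum_(i < N) _; lra.
Qed.

Theorem theorem2p18 (R : realType) (d : nat) (L mu kappa : R)
    (f : 'rV[R]_d -> R) (N : nat) (gamma : nat -> R) (x : nat -> 'rV[R]_d)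
    (L_gt0 : 0 < L) (mu_lt_L : mu < L) (kappaE : kappa = mu / L)
    (fF : F_class mu L f) (f_lb : has_lbound (range f)) (N_ge1 : (1 <= N)%N)
    (gammaE : forall i, (i < N)%N -> gamma i * L = normalized_step kappa i)
    (xE : forall i, (i < N)%N -> x i.+1 = x i - gamma i *: grad f (x i)) :
  1 / (2 * L) *
    \big[Num.min/enorm (grad f (x 0%N)) ^+ 2]_(i < N.+1)
      enorm (grad f (x i)) ^+ 2
  <= (f (x 0%N) - inf (range f)) /
     (1 + \sum_(i < N)
            gamma i * L * (2 - gamma i * L) * (2 - kappa * (gamma i * L))
            / (2 - gamma i * L * (1 + kappa))).
Proof.
have k1 : kappa < 1 by rewrite kappaE ltr_pdivrMr// mul1r.
pose t := capped_step kappa; pose G i := enorm (grad f (x i)) ^+ 2.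
set m := \big[_/_]_(i < _) _.
have mG i : (i <= N)%N -> m <= G i.
  move=> iN.
  exact: (bigmin_le _ (Ordinal (iN : (i < N.+1)%N))
    (fun j : 'I_N.+1 => G j)).
have tE i : (i < N)%N -> gamma i * L = t i.+1 by exact: gammaE.
have tP i : [/\ in_range kappa (t i.+1), 1 <= t i.+1 &
    0 <= pre_weight kappa (t i.+1) + post_weight kappa (t i)].
  exact: capped_stepP.
have c_ge0 : 0 <= 1 / (2 * L) by rewrite divr_ge0//; lra.
set S := \sum_(i < N) _.
have SE : S = \sum_(i < N)
    (pre_weight kappa (t i.+1) + post_weight kappa (t i.+1)).
  by apply: eq_bigr => i _; rewrite pre_post_weight tE.
have S_ge0 : 0 <= S.
  by rewrite SE; apply: sumr_ge0 => i _;
  by have [rt t1 _] := tP i; apply/ltW/step_gain_gt0 => //; lra.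
have main : 1 / (2 * L) * (m * S + post_weight kappa (t N) * (G N - m))
    <= f (x 0%N) - f (x N).
  rewrite SE; apply: (balanced_descent _ _ _ _ _ t (fun i => f (x i)) G) => //.
  - exact: capped_step0.
  - by move=> i _; case: (tP i).
  move=> i iN; have [rt t1 _] := tP i; have [_ _ _ D0] := in_rangeP _ _ rt.
  rewrite -tE// in t1 D0; rewrite -tE// div1r.
  have := gradient_step_decrease _ _ _ _ _ _ f (x i)
    L_gt0 mu_lt_L kappaE fF t1 D0.
  by rewrite -xE.
(* A step of length 1 / L from the last iterate decreases f by |g|^2 / (2 L). *)
have last_step : 1 / (2 * L) * G N <= f (x N) - inf (range f).
  pose z := x N - L^-1 *: grad f (x N).
  have inf_z : inf (range f) <= f z by apply: ge_inf => //; exists z.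
  have /andP[_] := F_class_quadratic mu L f (x N) z fF.
  have -> : z - x N = - (L^-1 *: grad f (x N)) by rewrite /z addrC addKr.
  rewrite /G enorm_sqr !dotE; set g := dot _ _.
  have -> : L / 2 * - - (L^-1 * (L^-1 * g)) = L^-1 * g / 2 by field; lra.
  have -> : 1 / (2 * L) * g = L^-1 * g / 2 by field; lra.
  lra.
have post_N : 0 <= post_weight kappa (t N).
  by apply: post_weight_ge0; case: (N) N_ge1 => // n _; case: (tP n).
rewrite ler_pdivlMr; last lra.
have := mulr_ge0 c_ge0 (mulr_ge0 post_N (_ : 0 <= G N - m)).
rewrite subr_ge0 mG// => /(_ isT).
have := ler_wpM2l c_ge0 (mG N (leqnn N)).
lra.
Qed.
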